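(* Let $k,n,m\ge 1$ be integers. The number of $k$-ary paths with $n$ up steps and $m$ peaks is equal to $$\frac{1}{m}\left(\binom{n-1}{m-1}\binom{kn-1}{m-2}+\binom{n-1}{m-1}\binom{kn-1}{m-1}\right)=\frac{1}{n}\binom{n}{m}\binom{kn}{m-1}.$$
   Context: A $k$-ary path is a lattice path in $\mathbb{Z}\times\mathbb{Z}$ starting at $(0,0)$ and ending on the $x$-axis, using up steps $(1,k)$ and down steps $(1,-1)$, and never going below the $x$-axis. (With $n$ up steps it has $kn$ down steps and ends at $((k+1)n,0)$.) A peak is an up step immediately followed by a down step. Binomial coefficients $\binom{N}{j}$ are $0$ when $j<0$ or $j>N\ge 0$. *)

(* Defs.v *)
From mathcomp Require Import all_boot all_order all_algebra.
From mathcomp Require Import classical_sets cardinality.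

Set Implicit Arguments.
Unset Strict Implicit.
Unset Printing Implicit Defensive.

Import Order.TTheory GRing.Theory Num.Theory.
Local Open Scope ring_scope.

(* A lattice path starting at (0, 0) is given by its sequence of steps. *)
Inductive step := Up | Down.

Definition is_up (s : step) : bool := if s is Up then true else false.
Definition is_down (s : step) : bool := ~~ is_up s.

Definition step_vec (k : nat) (s : step) : int * int :=
  if s is Up then (1, k%:Z) else (1, -1).

(* The lattice point reached after the first i steps (the endpoint as soon as
   size w <= i). *)
Definition point (k : nat) (w : seq step) (i : nat) : int * int :=
  \sum_(s <- take i w) step_vec k s.

Definition kary_path (k : nat) (w : seq step) : Prop :=
  (point k w (size w)).2 = 0 /\
  (forall i : nat, (i <= size w)%N -> 0 <= (point k w i).2).

Definition num_ups (w : seq step) : nat := count is_up w.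

(* zip w (behead w) lists the pairs of consecutive steps of w. *)
Definition num_peaks (w : seq step) : nat :=
  count (fun p => is_up p.1 && is_down p.2) (zip w (behead w)).

Definition kary_paths_with (k n m : nat) : set (seq step) :=
  [set w | kary_path k w /\ num_ups w = n /\ num_peaks w = m]%classic.

(* Binomial coefficient with an integer lower index, 0 when it is negative. *)
Definition binz (N : nat) (j : int) : nat :=
  if j is Posz i then 'C(N, i) else 0%N.

(* Main.v *)
Require Import Defs.
From mathcomp Require Import all_boot all_order all_algebra.
From mathcomp Require Import classical_sets cardinality.
From mathcomp Require Import zify.

Set Implicit Arguments.
Unset Strict Implicit.
Unset Printing Implicit Defensive.

Import Order.TTheory GRing.Theory Num.Theory.
Local Open Scope ring_scope.

(** Append one more down step to a k-ary path with n up steps and m peaks. The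
    result splits uniquely into m blocks, each a positive run of up steps
    followed by a positive run of down steps. The up-runs form a composition of
    n into m parts, the down-runs a composition of kn + 1 into m parts
    (kary_path_encodeP), and the word descends to height -1 at its last step and
    not before.

    Conversely take any two such compositions: 'C(n-1, m-1) * 'C(kn, m-1) pairs.
    The block rises sum to -1, so by the cycle lemma exactly one of the m cyclic
    rotations of the sequence of blocks stays nonnegative until its last block
    (cycle_lemma). For the word itself nonnegativity only has to be tested at
    block ends, because within a block the height first increases and then
    decreases (dominates_encode). Hence m times the number of paths is the
    number of pairs (card_dominating_blocks, card_kary_paths_with). It is
    essential that the sum be -1 and not 0: this makes the good rotation unique.

    The closed forms follow by Pascal's rule and by the absorption identity
    n * 'C(n-1, m-1) = m * 'C(n, m). For m > n both sides vanish, since every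
    peak uses up an up step. *)

(** * Integer sequences and the cycle lemma *)

(** Naming the sum lets lia treat it as an atom. *)
Definition sumz (c : seq int) : int := \sum_(x <- c) x.

Lemma sumz_nil : sumz [::] = 0.
Proof. by rewrite /sumz big_nil. Qed.

Lemma sumz_cons x c : sumz (x :: c) = x + sumz c.
Proof. by rewrite /sumz big_cons. Qed.

Lemma sumz_cat c1 c2 : sumz (c1 ++ c2) = sumz c1 + sumz c2.
Proof. by rewrite /sumz big_cat. Qed.

Lemma sumz_nseq n x : sumz (nseq n x) = x * n%:Z.
Proof. by rewrite /sumz big_nseq iter_addr_0 -mulr_natr natz. Qed.

(** Starting from height h, every partial sum of c is nonnegative, the last one
    (the sum of all of c) excepted. *)
Fixpoint dominates (h : int) (c : seq int) : bool :=
  if c is x :: c' then (0 <= h) && dominates (h + x) c' else true.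

Lemma dominatesP h c :
  reflect (forall i, (i < size c)%N -> 0 <= h + sumz (take i c))
          (dominates h c).
Proof.
apply: (iffP idP); elim: c h => [|x c IHc] h //=.
  move=> /andP[h_ge0 /IHc dom_c] [|i] lti; first by rewrite sumz_nil addr0.
  by rewrite sumz_cons addrA dom_c.
move=> dom_c; apply/andP; split.
  by have := dom_c 0%N isT; rewrite sumz_nil addr0.
apply: IHc => i lti.
by have := dom_c i.+1 lti; rewrite /= sumz_cons addrA.
Qed.

Lemma dominates_cat h c1 c2 :
  dominates h (c1 ++ c2) =
  dominates h c1 && dominates (h + sumz c1) c2.
Proof.
elim: c1 h => [|x c IHc] h /=; first by rewrite sumz_nil addr0.
by rewrite IHc sumz_cons addrA andbA.
Qed.

(** In terms of the partial sums S_i of c, the partial sums of the rotation by j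
    are S_i - S_j for i >= j and then S_i - S_j - 1 for i < j, since the whole
    sequence contributes -1. So the rotation dominates iff j is the first index
    at which S attains its minimum. *)
Lemma dominates_rotP (c : seq int) j :
    sumz c = -1 -> (j < size c)%N ->
  reflect (forall i, (i < size c)%N ->
             sumz (take j c) + (i < j)%N%:Z <= sumz (take i c))
          (dominates 0 (rot j c)).
Proof.
move=> sum_c ltj; rewrite /rot dominates_cat add0r.
have sum_drop i : sumz (take i c) + sumz (drop i c) = -1.
  by rewrite -sumz_cat cat_take_drop.
have eSD i : (j <= i)%N -> sumz (take i c) =
    sumz (take j c) + sumz (take (i - j) (drop j c)).
  by move=> le_ji; rewrite -sumz_cat -takeD subnKC.
have eST i : (i < j)%N -> take i (take j c) = take i c.
  by move=> lt_ij; rewrite take_takel // ltnW.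
apply: (iffP andP) => [[/dominatesP dom1 /dominatesP dom2] i lti|minj].
  case: ltnP => [lt_ij|le_ji] /=.
    have := dom2 i; rewrite size_take ltj eST // => /(_ lt_ij).
    by have := sum_drop j; lia.
  have := dom1 (i - j)%N; rewrite size_drop (eSD _ le_ji).
  by move=> /(_ ltac:(lia)); lia.
split; apply/dominatesP=> i.
  rewrite size_drop => lti; have := minj (j + i)%N ltac:(lia).
  by rewrite (eSD (j + i)%N) ?leq_addr // addKn ltnNge leq_addr /=; lia.
rewrite size_take ltj => lt_ij; rewrite eST //.
have := minj i ltac:(lia); rewrite lt_ij /=.
by have := sum_drop j; lia.
Qed.

(** The first minimum of the partial sums exists and is unique. *)
Lemma cycle_lemma (c : seq int) :
  sumz c = -1 -> (\sum_(j < size c) dominates 0 (rot j c) = 1)%N.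
Proof.
move=> sum_c; pose S i := sumz (take i c).
have size_gt0 : (0 < size c)%N by case: c sum_c {S} => //; rewrite sumz_nil.
pose first_min j := (j < size c)%N && [forall i : 'I_(size c), S j <= S i].
have [|j /andP[ltj /forallP minj] firstj] := @ex_minnP first_min.
  pose i0 := Ordinal size_gt0.
  have [i _ mini] := arg_minP (fun i : 'I_(size c) => S i) (erefl : predT i0).
  by exists i; apply/andP; split=> //; apply/forallP=> i'; exact: mini.
have dom_j : dominates 0 (rot j c).
  apply/dominates_rotP=> // i lti; rewrite -!/(S _).
  case: ltnP => [lt_ij|_]; last by rewrite addr0 (minj (Ordinal lti)).
  suff : S j < S i by lia.
  have : ~~ first_min i by apply: contraTN lt_ij => /firstj; rewrite -leqNgt.
  rewrite /first_min lti /= => /forallPn[i']; rewrite -ltNge.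
  by apply: le_lt_trans; exact: minj.
rewrite (bigD1 (Ordinal ltj)) //= dom_j big1 // => i ne_ij.
apply/eqP; rewrite eqb0; apply/negP => dom_i.
have := dominates_rotP sum_c ltj dom_j i (ltn_ord i).
have := dominates_rotP sum_c (ltn_ord i) dom_i j ltj.
have : (i != j :> nat) by apply: contra ne_ij => /eqP eij; apply/eqP/val_inj.
by lia.
Qed.

(** * Words as sequences of blocks *)

Definition rise (k : nat) (s : step) : int := (step_vec k s).2.

(** A pair (x, y) stands for the block of x + 1 up steps followed by y + 1 down
    steps, so that both runs are nonempty whatever the pair. *)
Definition block_rise (k : nat) (p : nat * nat) : int :=
  (k * p.1.+1)%N%:Z - p.2.+1%:Z.

Fixpoint encode (s : seq (nat * nat)) : seq step :=
  if s is p :: s' then nseq p.1.+1 Up ++ nseq p.2.+1 Down ++ encode s'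
  else [::].

(** Reads off b and s from nseq b Down ++ encode s. Allowing leading down steps
    makes this class of words stable under taking tails, as the structural
    recursion requires. The last branch is a default: an Up with no Down after
    it. *)
Fixpoint decode (w : seq step) : nat * seq (nat * nat) :=
  match w with
  | [::] => (0%N, [::])
  | Down :: w' => ((decode w').1.+1, (decode w').2)
  | Up :: w' =>
      match decode w' with
      | (b.+1, s) => (0%N, (0%N, b) :: s)
      | (0%N, p :: s) => (0%N, (p.1.+1, p.2) :: s)
      | (0%N, [::]) => (0%N, [::])
      end
  end.

Lemma decode_downs_encode b s : decode (nseq b Down ++ encode s) = (b, s).
Proof.
elim: s b => [|[x y] s IHs] b; elim: b => [|b IHb] //=; try by rewrite IHb.
suff -> : decode (nseq x Up ++ Down :: nseq y Down ++ encode s) =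
    if x is x'.+1 then (0%N, (x', y) :: s) else (y.+1, s) by case: x.
by elim: x => [|x IHx] /=; [rewrite IHs | rewrite IHx; case: x {IHx}].
Qed.

Lemma encode_inj : injective encode.
Proof.
by apply: (can_inj (g := fun w => (decode w).2)) => s;
  rewrite (decode_downs_encode 0).
Qed.

Lemma downs_encode_decode w :
  last Down w = Down -> nseq (decode w).1 Down ++ encode (decode w).2 = w.
Proof.
elim: w => //= -[] w IHw; last first.
  by move=> lw; rewrite /= IHw //; case: w {IHw} lw.
case: w IHw => // s w IHw lw; move: (IHw lw).
by case: (decode _) => [[|b] [|[x y] t]] //= ->.
Qed.

Lemma num_ups_encode s : num_ups (encode s) = (\sum_(p <- s) p.1.+1)%N.
Proof.
rewrite /num_ups; elim: s => [|p s IHs]; first by rewrite big_nil.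
by rewrite /= !count_cat /= !count_cat !count_nseq /= IHs big_cons; lia.
Qed.

Lemma num_peaks_cons s w :
  num_peaks (s :: w) = (is_up s && ~~ is_up (head Up w) + num_peaks w)%N.
Proof. by rewrite /num_peaks; case: w => [|[] w]; case: s. Qed.

(** Peaks occur exactly at the middle of each block. *)
Lemma num_peaks_encode s : num_peaks (encode s) = size s.
Proof.
elim: s => //= -[x y] s IHs /=.
have peaksD b : num_peaks (nseq b Down ++ encode s) = size s.
  by elim: b => [|b IHb] //=; rewrite num_peaks_cons.
elim: x => [|x IHx]; first by rewrite !num_peaks_cons /= peaksD.
by rewrite /= num_peaks_cons.
Qed.

Lemma sumz_rise_encode k s :
  sumz (map (rise k) (encode s)) = sumz (map (block_rise k) s).
Proof.
elim: s => [|[x y] s IHs] //.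
rewrite /= !map_cat !map_nseq !sumz_cons sumz_cat sumz_nseq.
rewrite /= sumz_cons map_cat map_nseq sumz_cat sumz_nseq IHs.
by rewrite /rise /block_rise /=; lia.
Qed.

Lemma encode_cons p s :
  encode (p :: s) = nseq p.1.+1 Up ++ (nseq p.2.+1 Down ++ encode s).
Proof. by []. Qed.

Lemma encode_rcons s : s <> [::] -> exists w, rcons w Down = encode s.
Proof.
elim: s => // p [|q s] IHs _; rewrite encode_cons.
  exists (nseq p.1.+1 Up ++ nseq p.2 Down).
  by rewrite cats0 -cats1 -catA -(nseqD _ 1) addn1.
have [//|w <-] := IHs.
by exists (nseq p.1.+1 Up ++ (nseq p.2.+1 Down ++ w)); rewrite !rcons_cat.
Qed.

Lemma sumz_block_rise k s :
  sumz (map (block_rise k) s) =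
  (k * \sum_(p <- s) p.1.+1)%N%:Z - (\sum_(p <- s) p.2.+1)%N%:Z.
Proof.
elim: s => [|p s IHs]; first by rewrite !big_nil muln0 sumz_nil.
by rewrite /= sumz_cons IHs !big_cons /block_rise; lia.
Qed.

Lemma dominates_nseq_ge0 h x n :
  0 <= x -> dominates h (nseq n.+1 x) = (0 <= h).
Proof.
move=> x_ge0; elim: n h => [|n IHn] h; first by rewrite /= andbT.
by rewrite -[LHS]/(_ && dominates _ (nseq n.+1 x)) IHn; lia.
Qed.

Lemma dominates_nseqN1 h n : dominates h (nseq n.+1 (-1)) = (n%:Z <= h).
Proof.
elim: n h => [|n IHn] h; first by rewrite /= andbT.
by rewrite -[LHS]/(_ && dominates _ (nseq n.+1 (-1))) IHn; lia.
Qed.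

(** The lowest points of the word are at block ends, so the word dominates as
    soon as its blocks do. The last block ends at -1 by hypothesis, and then its
    down-run stays nonnegative except at its very last step. *)
Lemma dominates_encode k s h :
    h + sumz (map (block_rise k) s) = -1 ->
  dominates h (map (rise k) (encode s)) = dominates h (map (block_rise k) s).
Proof.
elim: s h => [|p s IHs] h // sum_h; rewrite map_cons sumz_cons in sum_h.
rewrite encode_cons (map_cons (block_rise k)) [RHS]/= !map_cat !map_nseq.
rewrite !dominates_cat !sumz_nseq dominates_nseq_ge0 // dominates_nseqN1 -addrA.
have -> : rise k Up * p.1.+1%:Z + rise k Down * p.2.+1%:Z = block_rise k p.
  by rewrite /rise /block_rise /=; lia.
rewrite IHs; last by rewrite -sum_h; lia.
congr (_ && _); case dom_s : (dominates _ _); last by rewrite andbF.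
rewrite andbT; move: sum_h dom_s; rewrite /block_rise /rise /=.
case: (map _ s) => [|x c] /=; first by rewrite sumz_nil; lia.
by move=> _ /andP[]; lia.
Qed.

(** * Paths as dominating sequences of blocks *)

Lemma point_height k w i :
  (Defs.point k w i).2 = sumz (map (rise k) (take i w)).
Proof.
rewrite /Defs.point; elim: (take i w) => [|s u IHu].
  by rewrite big_nil sumz_nil.
by rewrite big_cons /= IHu sumz_cons.
Qed.

(** The final Down turns the endpoint of the path into an interior point, so that
    all the conditions of nonnegativity, including the one there, are those of
    dominates. *)
Lemma kary_pathE k w :
  kary_path k w <->
  sumz (map (rise k) (rcons w Down)) = -1 /\
  dominates 0 (map (rise k) (rcons w Down)).
Proof.
rewrite /kary_path point_height take_size map_rcons -cats1 sumz_cat.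
rewrite sumz_cons sumz_nil /rise /=.
have takeE i : (i <= size w)%N ->
    take i (map (rise k) w ++ [:: -1]) = map (rise k) (take i w).
  move=> lei; rewrite map_take take_cat size_map ltn_neqAle lei andbT.
  by case: eqP => //= ->; rewrite subnn cats0 -(size_map (rise k)) take_size.
split=> -[sum_w w_ge0]; split; try by move: sum_w; lia.
  apply/dominatesP=> i; rewrite size_cat size_map addn1 ltnS => lei.
  by rewrite takeE // add0r -point_height w_ge0.
move=> i lei; rewrite point_height -takeE // -[X in _ <= X]add0r.
by apply: (dominatesP _ _ w_ge0); rewrite size_cat size_map addn1 ltnS.
Qed.

(** An up step at the end would start from height -k. *)
Lemma kary_path_last k w : (0 < k)%N -> kary_path k w -> last Down w = Down.
Proof.
move=> k_gt0 [+ w_ge0]; case/lastP: w w_ge0 => // w [] w_ge0;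
  rewrite last_rcons // => sum_w.
have := w_ge0 (size w); rewrite size_rcons leqnSn => /(_ isT).
move: sum_w; rewrite !point_height take_size map_rcons -!cats1 take_size_cat //.
by rewrite sumz_cat sumz_cons sumz_nil /rise /=; lia.
Qed.

Lemma num_ups_rcons_Down w : num_ups (rcons w Down) = num_ups w.
Proof. by rewrite /num_ups -cats1 count_cat addn0. Qed.

Lemma num_peaks_rcons_Down w :
  last Down w = Down -> num_peaks (rcons w Down) = num_peaks w.
Proof.
elim: w => // s [|s' w] IHw lw; first by move: lw => /= ->.
by rewrite rcons_cons num_peaks_cons IHw // -num_peaks_cons.
Qed.

(** Decoding leaves no leading down-run, since such a step would already end the
    word. The appended Down creates no peak because a path ends with a down step;
    it is what makes the total of the down-runs kn + 1. *)
Lemma kary_path_encodeP k n m w :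
    (0 < k)%N -> (0 < n)%N ->
  kary_paths_with k n m w <->
  exists s, [/\ rcons w Down = encode s, size s = m,
    (\sum_(p <- s) p.1.+1)%N = n, (\sum_(p <- s) p.2.+1)%N = (k * n).+1 &
    dominates 0 (map (block_rise k) s)].
Proof.
move=> k_gt0 n_gt0; split=>
  [[path_w [ups_w peaks_w]]|[s [def_w sz_s ups_s downs_s dom_s]]].
  have [sum_w dom_w] := (kary_pathE k w).1 path_w.
  have lw : last Down (rcons w Down) = Down by rewrite last_rcons.
  have def_w : encode (decode (rcons w Down)).2 = rcons w Down.
    rewrite -[RHS](downs_encode_decode lw).
    (* A leading Down would reach height -1, hence be the only step. *)
    case: (decode _).1 (downs_encode_decode lw) => // b def_w.
    move: dom_w ups_w; rewrite -num_ups_rcons_Down -def_w /=.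
    case: (_ ++ _) => [|s u] /=; first by move=> _ n0; rewrite -n0 in n_gt0.
    by rewrite /rise /=.
  set s := (decode _).2 in def_w; exists s.
  rewrite -def_w sumz_rise_encode in sum_w.
  have ups_s : (\sum_(p <- s) p.1.+1)%N = n.
    by rewrite -num_ups_encode def_w num_ups_rcons_Down.
  split=> //.
  - rewrite -num_peaks_encode def_w num_peaks_rcons_Down //.
    exact: kary_path_last path_w.
  - by move: sum_w; rewrite sumz_block_rise ups_s; lia.
  - by rewrite -dominates_encode ?add0r // def_w.
have sum_s : sumz (map (block_rise k) s) = -1.
  by rewrite sumz_block_rise ups_s downs_s; lia.
have path_w : kary_path k w.
  by apply/kary_pathE; rewrite def_w sumz_rise_encode dominates_encode ?add0r.
split=> //; split; first by rewrite -num_ups_rcons_Down def_w num_ups_encode.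
rewrite -num_peaks_rcons_Down ?def_w ?num_peaks_encode //.
exact: kary_path_last path_w.
Qed.

(** * Counting dominating sequences of blocks *)

(** A composition of a + m into m positive parts is stored as the m-tuple of its
    parts minus one, each of which is at most a. *)
Definition blocks m a b (t : m.-tuple 'I_a.+1 * m.-tuple 'I_b.+1) :
    seq (nat * nat) :=
  zip (map val t.1) (map val t.2).

Definition dominating_blocks k m a b :
    {set m.-tuple 'I_a.+1 * m.-tuple 'I_b.+1} :=
  [set t : m.-tuple 'I_a.+1 * m.-tuple 'I_b.+1 |
    [&& (\sum_(i <- t.1) i == a)%N, (\sum_(i <- t.2) i == b)%N &
        dominates 0 (map (block_rise k) (blocks t))]].

Lemma size_blocks m a b (t : m.-tuple 'I_a.+1 * m.-tuple 'I_b.+1) :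
  size (blocks t) = m.
Proof. by rewrite size_zip !size_map !size_tuple minnn. Qed.

Lemma blocks_inj m a b : injective (@blocks m a b).
Proof.
move=> [s t] [s' t'] e; have /= := congr1 unzip1 e; have /= := congr1 unzip2 e.
rewrite !unzip1_zip ?unzip2_zip ?size_map ?size_tuple //=.
by move=> /(inj_map val_inj)/val_inj-> /(inj_map val_inj)/val_inj->.
Qed.

Lemma zip_rot (S T : Type) j (s : seq S) (t : seq T) :
  size s = size t -> zip (rot j s) (rot j t) = rot j (zip s t).
Proof.
move=> eq_sz; rewrite /rot zip_cat ?size_drop ?eq_sz //.
congr (_ ++ _).
  by elim: s t j eq_sz => [|x s IHs] [|y t] [|j] //= [/IHs].
by elim: s t j eq_sz => [|x s IHs] [|y t] [|j] //= [/IHs->].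
Qed.

Lemma sumn_succ (s : seq nat) :
  (\sum_(i <- s) i.+1 = \sum_(i <- s) i + size s)%N.
Proof. by elim: s => [|i s IHs]; rewrite ?big_nil // !big_cons IHs /=; lia. Qed.

Lemma sum_blocks1 m a b (t : m.-tuple 'I_a.+1 * m.-tuple 'I_b.+1) :
  (\sum_(p <- blocks t) p.1.+1 = \sum_(i <- t.1) i + m)%N.
Proof.
rewrite -(big_map fst xpredT succn) -/(unzip1 _).
rewrite unzip1_zip ?size_map ?size_tuple // sumn_succ.
by rewrite big_map size_map size_tuple.
Qed.

Lemma sum_blocks2 m a b (t : m.-tuple 'I_a.+1 * m.-tuple 'I_b.+1) :
  (\sum_(p <- blocks t) p.2.+1 = \sum_(i <- t.2) i + m)%N.
Proof.
rewrite -(big_map snd xpredT succn) -/(unzip2 _).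
rewrite unzip2_zip ?size_map ?size_tuple // sumn_succ.
by rewrite big_map size_map size_tuple.
Qed.

Lemma map_val_inord a (s : seq nat) :
  (\sum_(i <- s) i.+1 = a + size s)%N -> map val (map (@inord a) s) = s.
Proof.
rewrite sumn_succ => /addIn sum_s; rewrite -map_comp -[RHS]map_id.
apply/eq_in_map => i s_i; rewrite /= inordK // ltnS -sum_s.
by rewrite (big_rem i) //= leq_addr.
Qed.

Lemma blocks_surj m a b (s : seq (nat * nat)) :
    size s = m -> (\sum_(p <- s) p.1.+1 = a + m)%N ->
    (\sum_(p <- s) p.2.+1 = b + m)%N ->
  exists t : m.-tuple 'I_a.+1 * m.-tuple 'I_b.+1, blocks t = s.
Proof.
move=> sz_s; rewrite -(big_map fst xpredT succn) -(big_map snd xpredT succn).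
rewrite -{1 2}sz_s -{1}(size_map fst s) -{1}(size_map snd s).
move=> /map_val_inord e1 /map_val_inord e2.
have sz1 : size (map (@inord a) (unzip1 s)) == m by rewrite !size_map sz_s.
have sz2 : size (map (@inord b) (unzip2 s)) == m by rewrite !size_map sz_s.
by exists (Tuple sz1, Tuple sz2); rewrite /blocks /= e1 e2 zip_unzip.
Qed.

(** Simultaneous rotation of the two tuples permutes the pairs of compositions,
    and by the cycle lemma each pair has exactly one dominating rotation. *)
Lemma card_dominating_blocks k m a b :
    (k * (a + m.+1)).+1 = (b + m.+1)%N ->
  (m.+1 * #|dominating_blocks k m.+1 a b| = 'C(m + a, m) * 'C(m + b, m))%N.
Proof.
move=> eq_kab; rewrite -!card_ord_partitions -cardsX.
set T := finset.setX _ _.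
pose dom t := dominates 0 (map (block_rise k) (@blocks m.+1 a b t)).
pose rotate j (t : m.+1.-tuple 'I_a.+1 * m.+1.-tuple 'I_b.+1) :=
  ([tuple of rot j t.1], [tuple of rot j t.2]).
have rotate_inj j : injective (rotate j).
  by move=> [s t] [s' t'] [/rot_inj/val_inj-> /rot_inj/val_inj->].
have rotateT j t : (rotate j t \in T) = (t \in T).
  have sum_rot c (s : seq 'I_c.+1) :
      (\sum_(i <- rot j s) i = \sum_(i <- s) i)%N.
    by apply: perm_big; rewrite perm_rot.
  by rewrite !inE /= !sum_rot.
have dom_rotate j t :
    dom (rotate j t) = dominates 0 (rot j (map (block_rise k) (blocks t))).
  rewrite /dom /blocks /= -map_rot !map_rot zip_rot ?map_rot //.
  by rewrite !size_map !size_tuple.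
have one_rotation t : t \in T -> (\sum_(j < m.+1) dom (rotate j t) = 1)%N.
  rewrite !inE => /andP[/eqP sum1 /eqP sum2].
  under eq_bigr do rewrite dom_rotate.
  rewrite -[RHS](cycle_lemma (c := map (block_rise k) (blocks t))).
    by rewrite size_map size_blocks.
  by rewrite sumz_block_rise sum_blocks1 sum_blocks2 sum1 sum2; lia.
(* Count the pairs (j, t) for which the j-th rotation of t dominates: each t
   contributes 1, and each j contributes the number of dominating pairs. *)
rewrite -[RHS]sum1_card -(eq_bigr _ one_rotation) exchange_big /=.
rewrite (eq_bigr (fun=> #|dominating_blocks k m.+1 a b|)) => [|j _].
  by rewrite sum_nat_const card_ord.
transitivity (\sum_(t in T) dom t)%N.
  rewrite [RHS](reindex_inj (rotate_inj j)) /=.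
  by apply: eq_bigl => t; rewrite rotateT.
rewrite -sum1_card big_mkcond [RHS]big_mkcond; apply: eq_bigr => t _.
rewrite !inE /dom.
by case: eqP => //=; case: eqP => //=; case: dominates.
Qed.

(** * The number of paths *)

Lemma card_kary_paths_with k n m :
  (0 < k)%N -> (0 < m <= n)%N ->
  exists N, (kary_paths_with k n m #= `I_N)%card /\
    (m * N = 'C(n - 1, m - 1) * 'C(k * n, m - 1))%N.
Proof.
case: m => // m k_gt0 /= lt_mn.
have le_nkn : (n <= k * n)%N by rewrite leq_pmull.
pose a := (n - m.+1)%N; pose b := ((k * n).+1 - m.+1)%N.
have def_n : n = (a + m.+1)%N by rewrite /a; lia.
have def_kn : (k * n).+1 = (b + m.+1)%N by rewrite /b; lia.
exists #|dominating_blocks k m.+1 a b|; split; last first.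
  rewrite card_dominating_blocks -?def_n //.
  by congr ('C(_, _) * 'C(_, _))%N; lia.
(* Indexing by an ordinal identifies the dominating pairs with `I_N. *)
pose f (i : 'I_#|dominating_blocks k m.+1 a b|) := encode (blocks (enum_val i)).
have f_inj : injective f.
  by move=> i j /encode_inj/blocks_inj/enum_val_inj.
suff eq_img : ((rcons^~ Down) @` kary_paths_with k n m.+1 = f @` setT)%classic.
  have rconsI : {in kary_paths_with k n m.+1 &, injective (rcons^~ Down)}.
    by move=> w w' _ _; exact: rcons_injl.
  rewrite -(card_eql (inj_card_eq rconsI)) eq_img (card_eqr card_II).
  by apply: inj_card_eq => i j _ _; exact: f_inj.
have n_gt0 : (0 < n)%N by lia.
apply/seteqP; split=>
  [_ [w /(kary_path_encodeP _ _ k_gt0 n_gt0) + <-]|_ [i _ <-]] /=.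
  case=> s [-> sz_s ups_s downs_s dom_s].
  rewrite def_n in ups_s; rewrite def_kn in downs_s.
  have [t def_s] := blocks_surj sz_s ups_s downs_s.
  rewrite -{}def_s in dom_s ups_s downs_s *.
  have t_in : t \in dominating_blocks k m.+1 a b.
    rewrite inE dom_s andbT; move: ups_s downs_s.
    by rewrite sum_blocks1 sum_blocks2 => /addIn-> /addIn->; rewrite !eqxx.
  by exists (enum_rank_in t_in t) => //; rewrite /f enum_rankK_in.
have := enum_valP i; rewrite inE /f; set t := enum_val i.
case/and3P=> /eqP sum1 /eqP sum2 dom_t.
have sz_t := size_blocks t.
have [w def_w] : exists w, rcons w Down = encode (blocks t).
  by apply: encode_rcons => bt0; rewrite bt0 in sz_t.
exists w => //; apply/(kary_path_encodeP _ _ k_gt0 n_gt0).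
exists (blocks t); split=> //.
  by rewrite sum_blocks1 sum1.
by rewrite sum_blocks2 sum2.
Qed.

Lemma num_peaks_le_ups w : (num_peaks w <= num_ups w)%N.
Proof.
elim: w => // s w IHw; rewrite num_peaks_cons /num_ups /= leq_add //.
by case: s => //=; case: is_up.
Qed.

Lemma kary_paths_with0 k n m :
  (n < m)%N -> kary_paths_with k n m = set0.
Proof.
move=> lt_nm; apply/seteqP; split=> // w [_ [ups_w peaks_w]].
by move: (num_peaks_le_ups w); rewrite ups_w peaks_w leqNgt lt_nm.
Qed.

Theorem mainTheorem3 (k n m : nat) (hk : (1 <= k)%N) (hn : (1 <= n)%N)
    (hm : (1 <= m)%N) :
  exists N : nat,
    (kary_paths_with k n m #= `I_N)%card /\
    N%:R = (m%:R)^-1 *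
      (('C(n - 1, m - 1))%:R * (binz (k * n - 1) (m%:Z - 2))%:R +
       ('C(n - 1, m - 1))%:R * ('C(k * n - 1, m - 1))%:R) :> rat /\
    (m%:R)^-1 *
      (('C(n - 1, m - 1))%:R * (binz (k * n - 1) (m%:Z - 2))%:R +
       ('C(n - 1, m - 1))%:R * ('C(k * n - 1, m - 1))%:R)
    = (n%:R)^-1 * ('C(n, m))%:R * ('C(k * n, m - 1))%:R :> rat.
Proof.
have kn_gt0 : (0 < k * n)%N by rewrite muln_gt0 hk.
have pascal : (binz (k * n - 1) (m%:Z - 2) + 'C(k * n - 1, m - 1) =
               'C(k * n, m - 1))%N.
  rewrite -[in RHS](prednK kn_gt0) -subn1.
  case: m hm => [|[|m]] // _; first by rewrite subnn !bin0.
  have -> : m.+2%:Z - 2 = m%:Z by lia.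
  by rewrite !subn1 /= binS addnC.
have m_neq0 : m%:R != 0 :> rat by rewrite pnatr_eq0 -lt0n.
have n_neq0 : n%:R != 0 :> rat by rewrite pnatr_eq0 -lt0n.
have absorb : n%:R * ('C(n - 1, m - 1))%:R = m%:R * ('C(n, m))%:R :> rat.
  by rewrite -!natrM -{2 3}(prednK hm) subn1 [in LHS]subn1 mul_bin_diag.
rewrite -mulrDr -natrD pascal.
suff [N [card_N eq_N]] : exists N, (kary_paths_with k n m #= `I_N)%card /\
    (m * N = 'C(n - 1, m - 1) * 'C(k * n, m - 1))%N.
  exists N; split=> //; split; first by rewrite -natrM -eq_N natrM mulKf.
  have -> : ('C(n - 1, m - 1))%:R = n%:R^-1 * (m%:R * ('C(n, m))%:R) :> rat.
    by rewrite -absorb mulKf.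
  by rewrite [_ * (m%:R * _)]mulrCA !mulrA mulVf ?mul1r.
have [le_mn|lt_nm] := leqP m n; first by apply: card_kary_paths_with; rewrite ?hm.
exists 0%N; rewrite kary_paths_with0 // II0; split=> //.
by rewrite muln0 bin_small //; lia.
Qed.
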